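(* Let $T$ be a (bounded) distributive lattice. The space $\mathrm{Jspec}\,T$ is a spectral subspace of $\mathrm{Spec}\,T$, canonically homeomorphic to $\mathrm{Spec}(\mathrm{He}(T))$. More precisely, writing $M=\mathrm{Max}\,T$, for all $a,b\in T$ one has $$\mathfrak{D}_T(a)\cap M\subseteq \mathfrak{D}_T(b)\cap M\quad\Longleftrightarrow\quad a\preceq_{\mathrm{He}(T)} b .$$
   Context: The setting is classical mathematics. Distributive lattices have a minimum $0$ and a maximum $1$, preserved by morphisms. $\mathrm{Spec}\,T$ is the set of prime ideals of $T$ (ideals whose complement is a filter), with the topology having as a base of open sets the sets $\mathfrak{D}_T(a)=\{\mathfrak p\in \mathrm{Spec}\,T : a\notin\mathfrak p\}$, $a\in T$. A spectral space is a space homeomorphic to some $\mathrm{Spec}\,T$. The constructible topology on $\mathrm{Spec}\,T$ has as basic open sets the $\mathfrak{D}_T(a)\setminus\mathfrak{D}_T(b)$, $a,b\in T$. If $\pi:T\to T'$ is a quotient lattice of $T$, the dual map $\pi^\star:\mathrm{Spec}\,T'\to\mathrm{Spec}\,T$, $\mathfrak q\mapsto\pi^{-1}(\mathfrak q)$, is injective, and a spectral subspace of $\mathrm{Spec}\,T$ is a subset which is the image of such a map, with the induced topology. $\mathrm{Max}\,T$ is the set of maximal ideals of $T$ (maximal among proper ideals), as a subspace of $\mathrm{Spec}\,T$. $\mathrm{Jspec}\,T$ is the closure of $\mathrm{Max}\,T$ in $\mathrm{Spec}\,T$ for the constructible topology, equipped with the topology induced by that of $\mathrm{Spec}\,T$.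 For $b\in T$, $J_T(b)=\{a\in T : \forall x\in T\ (a\vee x=1\Rightarrow b\vee x=1)\}$. The Heitmann lattice $\mathrm{He}(T)$ is the quotient lattice of $T$ defined by the preorder $a\preceq_{\mathrm{He}(T)}b$ iff $J_T(a)\subseteq J_T(b)$; equivalently $\forall x\in T\ (a\vee x=1\Rightarrow b\vee x=1)$. *)

(* Defs.v *)
From HB Require Import structures.
From mathcomp Require Import all_boot all_order all_classical.
From mathcomp Require Import topology.

Set Implicit Arguments.
Unset Strict Implicit.
Unset Printing Implicit Defensive.

Import Order.TTheory.
Local Open Scope classical_set_scope.

(* MathComp's {tblmorphism T -> T'} only asks that \bot and \top be preserved,
   and {lmorphism T -> T'} only that meets and joins are. *)
HB.structure Definition BoundedLatticeMorphism d (T : tbLatticeType d)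
    d' (T' : tbLatticeType d') :=
  {f of @Order.LatticeMorphism d T d' T' f &
        @Order.TBLatticeMorphism d T d' T' f}.

Section PrimeIdeals.
Context d (T : tbDistrLatticeType d).
Implicit Types (I F J : set T) (a b : T).

Definition is_ideal I : Prop :=
  [/\ I \bot%O,
      forall a b, I a -> I b -> I (a `|` b)%O
    & forall a b, (a <= b)%O -> I b -> I a].

Definition is_filter F : Prop :=
  [/\ F \top%O,
      forall a b, F a -> F b -> F (a `&` b)%O
    & forall a b, (a <= b)%O -> F a -> F b].

Definition prime_ideal I : Prop := is_ideal I /\ is_filter (~` I).

Definition maximal_ideal I : Prop :=
  [/\ is_ideal I, I <> setT
    & forall J, is_ideal J -> J <> setT -> I `<=` J -> J = I].

(* Hence no maximal ideal is lost in viewing Max T as a subset of Spec T. *)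
Lemma maximal_ideal_prime I : maximal_ideal I -> prime_ideal I.
Proof.
move=> [[I0 IU Ile] IT Imax]; split=> //.
have I1 : ~ I \top%O.
  by move=> I1; apply: IT; rewrite -subTset => x _; apply: Ile I1; exact: lex1.
split=> //; last by move=> a b ab Ia Ib; apply/Ia/(Ile _ _ ab).
(* I + (c) is not proper when c is not in I *)
have ext c : ~ I c -> exists2 i, I i & (i `|` c)%O = \top%O.
  move=> Ic; apply: contrapT => Hc.
  pose J := [set x | exists2 i, I i & (x <= i `|` c)%O].
  suff JI : J = I by apply: Ic; rewrite -JI; exists \bot%O; rewrite ?leUr.
  apply: Imax; last by move=> x Ix; exists x; rewrite ?leUl.
  - split; first by exists \bot%O; rewrite ?le0x.
    + move=> x y [i Ii xi] [j Ij yj]; exists (i `|` j)%O; first exact: IU.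
      by rewrite leUx (le_trans xi) ?leU2 ?leUl //= (le_trans yj) ?leU2 ?leUr.
    + by move=> x y xy [i Ii yi]; exists i => //; exact: le_trans yi.
  - move=> JT; have [i Ii] : J \top%O by rewrite JT.
    by rewrite le1x => /eqP ic; apply: Hc; exists i.
move=> a b /ext[i Ii ia] /ext[j Ij jb] Iab; apply: I1.
have Ix : I ((i `|` j) `|` (a `&` b))%O by apply: (IU) => //; exact: IU.
apply: Ile Ix; rewrite joinIr lexI -[X in (X <= _)%O && _]ia.
by rewrite -[X in _ && (X <= _)%O]jb !leU2 ?leUl ?leUr.
Qed.

End PrimeIdeals.

Record Spec d (T : tbDistrLatticeType d) := MkSpec {
  spec_ideal : set T;
  spec_prime : prime_ideal spec_ideal }.

Section SpecTopology.
Context d (T : tbDistrLatticeType d).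
Implicit Types (a b : T) (p q : Spec T).

Lemma spec_ext p q : spec_ideal p = spec_ideal q -> p = q.
Proof.
by case: p q => [p pP] [q qP] /= E; case: q / E qP => qP; congr MkSpec.
Qed.

Lemma spec_0 p : spec_ideal p \bot%O.
Proof. by case: (spec_prime p) => -[]. Qed.

Lemma spec_1 p : ~ spec_ideal p \top%O.
Proof. by case: (spec_prime p) => _ []. Qed.

Lemma spec_U p a b :
  spec_ideal p (a `|` b)%O <-> spec_ideal p a /\ spec_ideal p b.
Proof.
case: (spec_prime p) => -[_ pU ple] _.
by split=> [H|[]]; [split; apply: ple H; rewrite ?leUl ?leUr | exact: pU].
Qed.

Lemma spec_I p a b :
  spec_ideal p (a `&` b)%O <-> spec_ideal p a \/ spec_ideal p b.
Proof.
case: (spec_prime p) => -[_ _ ple] [_ pI _]; split; last first.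
  by case=> H; apply: ple H; rewrite ?leIl ?leIr.
by move=> pab; apply: contrapT => /not_orP[pa pb]; exact: pI pab.
Qed.

Definition Dspec a : set (Spec T) := [set p | ~ spec_ideal p a].

Definition constructible_base : set (set (Spec T)) :=
  [set U | exists a b, U = Dspec a `\` Dspec b].

HB.instance Definition _ := gen_eqMixin (Spec T).
HB.instance Definition _ := gen_choiceMixin (Spec T).

Fact Dspec_cover : \bigcup_(U in range Dspec) U = setT.
Proof.
apply/seteqP; split=> // p _; exists (Dspec \top%O); last exact: spec_1.
by exists \top%O.
Qed.

Fact Dspec_join (U V : set (Spec T)) p :
  range Dspec U -> range Dspec V -> U p -> V p ->
  exists W, [/\ range Dspec W, W p & W `<=` U `&` V].
Proof.
move=> [a _ <-] [b _ <-] pa pb; exists (Dspec (a `&` b)%O); split.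
- by exists (a `&` b)%O.
- by move=> /spec_I[].
- by move=> q qab; split=> ?; apply/qab/spec_I; [left|right].
Qed.

HB.instance Definition _ :=
  isBaseTopological.Build (Spec T) Dspec_cover Dspec_join.

(* The same points as Spec T, with the constructible topology. *)
Definition constructible_Spec : Type := Spec T.

HB.instance Definition _ := Choice.on constructible_Spec.

Fact constructible_cover : \bigcup_(U in constructible_base) U = setT.
Proof.
apply/seteqP; split=> // p _; exists (Dspec \top%O `\` Dspec \bot%O).
  by exists \top%O, \bot%O.
by split; [exact: spec_1 | apply; exact: spec_0].
Qed.

Fact constructible_join (U V : set (Spec T)) p :
  constructible_base U -> constructible_base V -> U p -> V p ->
  exists W, [/\ constructible_base W, W p & W `<=` U `&` V].
Proof.
move=> [a [b ->]] [a' [b' ->]] [pa /contrapT pb] [pa' /contrapT pb'].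
exists (Dspec (a `&` a')%O `\` Dspec (b `|` b')%O); split.
- by exists (a `&` a')%O, (b `|` b')%O.
- by split; [move=> /spec_I[] | apply; apply/spec_U].
- move=> q [qa /contrapT/spec_U[qb qb']].
  by split; split; try apply; move=> // ?; apply/qa/spec_I; [left|right].
Qed.

HB.instance Definition _ := @isBaseTopological.Build constructible_Spec
  _ _ _ constructible_cover constructible_join.

End SpecTopology.

Definition Max d (T : tbDistrLatticeType d) : set (Spec T) :=
  [set p | maximal_ideal (spec_ideal p)].
Arguments Max {d} T _ : assert.

(* As a type, Jspec T carries the topology induced by that of Spec T. *)
Definition Jspec d (T : tbDistrLatticeType d) : set (Spec T) :=
  @closure (constructible_Spec T) (Max T).
Arguments Jspec {d} T _ : assert.

Section DualMap.
Context d (T : tbDistrLatticeType d) d' (T' : tbDistrLatticeType d').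
Variable f : BoundedLatticeMorphism.type T T'.

Fact dual_prime (q : Spec T') : prime_ideal (f @^-1` spec_ideal q).
Proof.
case: (spec_prime q) => -[q0 qU qle] [q1 qI qge].
split; split; rewrite /preimage /=.
- by rewrite omorph0.
- by move=> a b; rewrite omorphU; exact: qU.
- by move=> a b ab; apply: qle; exact: omorph_le.
- by rewrite omorph1.
- by move=> a b; rewrite /= omorphI; exact: qI.
- by move=> a b ab; apply: qge; exact: omorph_le.
Qed.

Definition dual_map (q : Spec T') : Spec T := MkSpec (dual_prime q).

End DualMap.

(* A quotient lattice of T is given by a surjective morphism onto a bounded
   distributive lattice. *)
Definition spectral_subspace d (T : tbDistrLatticeType d)
    (A : set (Spec T)) : Prop :=
  exists (d' : Order.disp_t) (T' : tbDistrLatticeType d')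
    (f : BoundedLatticeMorphism.type T T'),
    range f = setT /\ A = range (dual_map f).

Definition homeomorphism (X Y : topologicalType) (f : X -> Y) : Prop :=
  exists g : Y -> X,
    [/\ cancel f g, cancel g f, continuous f & continuous g].

Section Heitmann.
Context d (T : tbDistrLatticeType d).
Implicit Types (a b x y : T).

Definition J_ideal b : set T :=
  [set a | forall x, (a `|` x = \top -> b `|` x = \top)%O].

Definition he_le a b : Prop := J_ideal a `<=` J_ideal b.

Lemma he_leP a b :
  he_le a b <-> forall x, (a `|` x = \top -> b `|` x = \top)%O.
Proof. by split=> [ab|ab c ac x /ac/ab]; [exact: (ab a) | ]. Qed.

Lemma he_le_refl a : he_le a a.
Proof. exact: subset_refl. Qed.

Lemma he_le_trans b a c : he_le a b -> he_le b c -> he_le a c.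
Proof. exact: subset_trans. Qed.

Lemma le_he_le a b : (a <= b)%O -> he_le a b.
Proof.
move=> ab; apply/he_leP => x ax; apply/eqP; rewrite -le1x -ax.
by rewrite leU2.
Qed.

Lemma he_le_joinP a b c : he_le (a `|` b)%O c <-> he_le a c /\ he_le b c.
Proof.
split=> [H|[/he_leP ac /he_leP bc]].
  by split; apply: he_le_trans H; apply: le_he_le; rewrite ?leUl ?leUr.
apply/he_leP => x; rewrite -joinA => /ac; rewrite joinCA => /bc.
by rewrite joinA joinxx.
Qed.

Lemma he_le_meetP a b c : he_le c (a `&` b)%O <-> he_le c a /\ he_le c b.
Proof.
split=> [H|[/he_leP ca /he_leP cb]].
  by split; apply: he_le_trans H _; apply: le_he_le; rewrite ?leIl ?leIr.
by apply/he_leP => x cx; rewrite joinIl ca ?cb ?meetxx.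
Qed.

Definition he_eq a b : bool := `[< he_le a b /\ he_le b a >].

Fact he_eq_refl : reflexive he_eq.
Proof. by move=> a; apply/asboolP; split; exact: he_le_refl. Qed.

Fact he_eq_sym : symmetric he_eq.
Proof. by move=> a b; apply/asboolP/asboolP => -[]. Qed.

Fact he_eq_trans : transitive he_eq.
Proof.
move=> b a c /asboolP[ab ba] /asboolP[bc cb]; apply/asboolP.
by split; [exact: he_le_trans bc | exact: he_le_trans ba].
Qed.

Canonical he_equiv := EquivRel he_eq he_eq_refl he_eq_sym he_eq_trans.

Definition He : Type := {eq_quot he_equiv}%qT.

HB.instance Definition _ := Choice.on He.
HB.instance Definition _ := Quotient.on He.
HB.instance Definition _ := EqQuotient.on He.

Definition he_pi : T -> He := \pi_He%qT.

Definition He_le (u v : He) : bool := `[< he_le (repr u) (repr v) >].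
Definition He_meet (u v : He) : He := he_pi (repr u `&` repr v)%O.
Definition He_join (u v : He) : He := he_pi (repr u `|` repr v)%O.

Lemma he_pi_eqP a b : he_pi a = he_pi b <-> he_le a b /\ he_le b a.
Proof.
split=> [|ab]; first by move=> /eqmodP /asboolP.
by apply/eqmodP/asboolP.
Qed.

Lemma repr_he_pi a : he_le (repr (he_pi a)) a /\ he_le a (repr (he_pi a)).
Proof. by apply/he_pi_eqP; rewrite /he_pi reprK. Qed.

Lemma he_piP (u : He) : exists a, u = he_pi a.
Proof. by exists (repr u); rewrite /he_pi reprK. Qed.

Lemma He_le_pi a b : He_le (he_pi a) (he_pi b) <-> he_le a b.
Proof.
have [a1 a2] := repr_he_pi a; have [b1 b2] := repr_he_pi b.
split=> [/asboolP ab|ab]; first exact: he_le_trans (he_le_trans ab b1).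
by apply/asboolP; exact: he_le_trans (he_le_trans ab b2).
Qed.

Fact He_refl : reflexive He_le.
Proof. by move=> u; apply/asboolP; exact: he_le_refl. Qed.

Fact He_anti : antisymmetric He_le.
Proof.
move=> u v; have [a ->] := he_piP u; have [b ->] := he_piP v.
by move=> /andP[/He_le_pi ab /He_le_pi ba]; apply/he_pi_eqP.
Qed.

Fact He_trans : transitive He_le.
Proof.
by move=> v u w /asboolP uv /asboolP vw; apply/asboolP; exact: he_le_trans vw.
Qed.

HB.instance Definition _ :=
  Order.Le_isPOrder.Build d He He_refl He_anti He_trans.

Lemma le_he_pi a b : (he_pi a <= he_pi b)%O <-> he_le a b.
Proof. exact: He_le_pi. Qed.

Fact He_meetP (u v w : He) :
  (u <= He_meet v w)%O = (u <= v)%O && (u <= w)%O.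
Proof.
have [a ->] := he_piP u; rewrite -[v in RHS]reprK -[w in RHS]reprK.
apply/idP/andP => [/le_he_pi/he_le_meetP[]|[]].
  by move=> ? ?; split; apply/le_he_pi.
by move=> /le_he_pi ? /le_he_pi ?; apply/le_he_pi/he_le_meetP.
Qed.

Fact He_joinP (u v w : He) :
  (He_join u v <= w)%O = (u <= w)%O && (v <= w)%O.
Proof.
have [a ->] := he_piP w; rewrite -[u in RHS]reprK -[v in RHS]reprK.
apply/idP/andP => [/le_he_pi/he_le_joinP[]|[]].
  by move=> ? ?; split; apply/le_he_pi.
by move=> /le_he_pi ? /le_he_pi ?; apply/le_he_pi/he_le_joinP.
Qed.

HB.instance Definition _ :=
  Order.POrder_MeetJoin_isLattice.Build d He He_meetP He_joinP.

Fact he_pi_le : {homo he_pi : a b / (a <= b)%O}.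
Proof. by move=> a b ab; apply/le_he_pi/le_he_le. Qed.

Fact he_pi_meet : Order.meet_morphism he_pi.
Proof.
move=> a b; have [a1 a2] := repr_he_pi a; have [b1 b2] := repr_he_pi b.
apply/he_pi_eqP; split; apply/he_le_meetP; split.
- by apply: he_le_trans a2; apply/le_he_le/leIl.
- by apply: he_le_trans b2; apply/le_he_le/leIr.
- by apply: he_le_trans a1; apply/le_he_le/leIl.
- by apply: he_le_trans b1; apply/le_he_le/leIr.
Qed.

Fact he_pi_join : Order.join_morphism he_pi.
Proof.
move=> a b; have [a1 a2] := repr_he_pi a; have [b1 b2] := repr_he_pi b.
apply/he_pi_eqP; split; apply/he_le_joinP; split.
- by apply: (he_le_trans a2); apply/le_he_le/leUl.
- by apply: (he_le_trans b2); apply/le_he_le/leUr.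
- by apply: (he_le_trans a1); apply/le_he_le/leUl.
- by apply: (he_le_trans b1); apply/le_he_le/leUr.
Qed.

Fact He_meetUl : left_distributive (@Order.meet d He) (@Order.join d He).
Proof.
move=> u v w; have [a ->] := he_piP u; have [b ->] := he_piP v.
by have [c ->] := he_piP w; rewrite -he_pi_join -!he_pi_meet -he_pi_join meetUl.
Qed.

HB.instance Definition _ :=
  Order.Lattice_Meet_isDistrLattice.Build d He He_meetUl.

Fact He_le0x (u : He) : (he_pi \bot%O <= u)%O.
Proof. by have [a ->] := he_piP u; apply/he_pi_le/le0x. Qed.

Fact He_lex1 (u : He) : (u <= he_pi \top%O)%O.
Proof. by have [a ->] := he_piP u; apply/he_pi_le/lex1. Qed.

HB.instance Definition _ := Order.hasBottom.Build d He He_le0x.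
HB.instance Definition _ := Order.hasTop.Build d He He_lex1.

HB.instance Definition _ := Order.isOrderMorphism.Build d T d He he_pi he_pi_le.
HB.instance Definition _ :=
  Order.isMeetLatticeMorphism.Build d T d He he_pi he_pi_meet.
HB.instance Definition _ :=
  Order.isJoinLatticeMorphism.Build d T d He he_pi he_pi_join.
HB.instance Definition _ := Order.isBLatticeMorphism.Build d T d He he_pi erefl.
HB.instance Definition _ := Order.isTLatticeMorphism.Build d T d He he_pi erefl.

End Heitmann.

(* Main.v *)
Require Import Defs.
From mathcomp Require Import all_boot all_order all_classical topology.

Set Implicit Arguments.
Unset Strict Implicit.
Unset Printing Implicit Defensive.

Import Order.TTheory.
Local Open Scope classical_set_scope.

(** Every proper ideal lies in a maximal one, and a maximal ideal that misses
    [a] contains some [x] with [a `|` x = \top].  So some maximal ideal contains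
    [b] but not [a] exactly when the Heitmann preorder [he_le a b] fails: this
    is [he_le_Max].

    A constructible neighbourhood of a prime [p] is given by some [a] outside
    [p] and some [b] inside, and it meets [Max T] exactly when some maximal
    ideal contains [b] but not [a].  By [he_le_Max] the closure [Jspec T] thus
    consists of the primes [p] with [a \in p] whenever [he_le a b] and
    [b \in p] ([JspecP]).  For any quotient [f : T -> T'], the primes that are
    closed downwards for the preorder [f a <= f b] are the inverse images of
    the primes of [T'] ([range_dual_map]); applied to [T -> He T], this
    identifies [Jspec T] with the image of [Spec (He T)].  The dual map is a
    homeomorphism onto its image because [Dspec (f a)] is the inverse image of
    [Dspec a] and [f] is onto, so that these are all the basic open sets
    ([dual_map_homeomorphism]). *)

(** Zorn's lemma is applied to the sets [X] for which [I `|` X] is a proper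
    ideal, rather than to the proper ideals containing [I]: the empty chain,
    whose union is empty, then needs no separate treatment. *)
Lemma ideal_sub_maximal d (T : tbDistrLatticeType d) (I : set T) :
  is_ideal I -> ~ I \top%O -> exists2 J, maximal_ideal J & I `<=` J.
Proof.
move=> idI I1; have [I0 IU Ile] := idI.
pose P (X : set T) := is_ideal (I `|` X) /\ ~ X \top%O.
have [F FP Ftot|X [[idX X1] Xmax]] := @Zorn_bigcup T P.
  split; last by move=> [X FX X1]; have [_] := FP X FX; apply.
  split; first by left.
  (* a chain reduces the join of two elements to the case of one member *)
  - have up X a b : F X -> (I `|` X) a -> (I `|` X) b ->
        (I `|` \bigcup_(X in F) X) (a `|` b)%O.
      move=> FX Xa Xb; have [[_ XU _] _] := FP X FX.
      by have [|] := XU _ _ Xa Xb; [left | right; exists X].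
    move=> a b [Ia|[X FX Xa]] [Ib|[Y FY Yb]].
    + by left; exact: IU.
    + by apply: (up Y) => //; [left|right].
    + by apply: (up X) => //; [right|left].
    + have [XY|YX] := Ftot X Y FX FY.
        by apply: (up Y) => //; right => //; exact: XY.
      by apply: (up X) => //; right => //; exact: YX.
  - move=> a b ab [Ib|[X FX Xb]]; first by left; exact: Ile Ib.
    have [[_ _ Xle] _] := FP X FX.
    by have [||] := Xle a b ab; [right|left|right; exists X].
exists (I `|` X); last exact: subsetUl.
split=> // [XT|J idJ JT XJ].
  by have [] : (I `|` X) \top%O by rewrite XT.
have [_ _ Jle] := idJ.
have IJ : I `|` J = J by apply/setUidPr; apply: subset_trans XJ; exact: subsetUl.
apply/seteqP; split=> // y Jy; right; apply: contrapT => Xy.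
apply: (Xmax J).
  split; last by move=> /(_ y Jy).
  by apply: subset_trans XJ; exact: subsetUr.
split; first by rewrite IJ.
by move=> J1; apply: JT; rewrite -subTset => z _; apply: Jle J1; exact: lex1.
Qed.

Section JacobsonSpectrum.
Context d (T : tbDistrLatticeType d).
Implicit Types (a b : T) (p : Spec T).

(** Otherwise the ideal generated by [p] and [a] would be proper and
    strictly larger than [p]. *)
Lemma maximal_avoid p a :
  Max T p -> ~ spec_ideal p a ->
  exists2 x, spec_ideal p x & (a `|` x = \top)%O.
Proof.
move=> [[p0 pU ple] pT pmax] pa; apply: contrapT => Hx.
pose J := [set y | exists2 x, spec_ideal p x & (y <= a `|` x)%O].
suff Jp : J = spec_ideal p.
  by apply: pa; rewrite -Jp; exists \bot%O; rewrite ?leUl.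
apply: pmax; last by move=> x px; exists x; rewrite ?leUr.
- split; first by exists \bot%O; rewrite ?le0x.
  + move=> y z [x px yx] [x' px' zx']; exists (x `|` x')%O; first exact: pU.
    by rewrite -(joinxx a) joinACA leU2.
  + by move=> y z yz [x px zx]; exists x => //; exact: le_trans zx.
- move=> JT; have [x px] : J \top%O by rewrite JT.
  by rewrite le1x => /eqP ax; apply: Hx; exists x.
Qed.

(** If [a `|` x = \top] but [b `|` x] is not [\top], then a maximal ideal
    containing [b `|` x] contains [b] and not [a].  Conversely, in a
    maximal ideal that contains [b] but not [a], some [x] has
    [a `|` x = \top], and [b `|` x] lies in that ideal, hence is not [\top]. *)
Lemma he_le_Max a b :
  Dspec a `&` Max T `<=` Dspec b `&` Max T <-> he_le a b.
Proof.
split=> [ab|/he_leP ab p [pa pM]]; last first.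
  split=> // pb; have [x px ax] := maximal_avoid pM pa.
  by apply: (@spec_1 _ _ p); rewrite -(ab x ax); apply/spec_U.
apply/he_leP => x ax; apply: contrapT => /eqP bx.
(* the maximal ideal is taken above the principal ideal of b `|` x *)
have [||m mmax mI] := @ideal_sub_maximal _ T [set y | (y <= b `|` x)%O].
- split; first exact: le0x.
  + by move=> y z /= yb zb; rewrite leUx yb.
  + by move=> y z /= yz; exact: le_trans.
- by rewrite /= le1x; exact/negP.
have [mb mx] : m b /\ m x by split; apply: mI; rewrite /= ?leUl ?leUr.
pose p := MkSpec (maximal_ideal_prime mmax).
have : ~ Dspec b p by apply.
apply; apply: (ab p _).1; split=> //= ma.
by apply: (@spec_1 _ _ p); rewrite -ax; apply/spec_U.
Qed.

Lemma nbhs_SpecP p (U : set (Spec T)) :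
  nbhs p U <-> exists2 a, Dspec a p & Dspec a `<=` U.
Proof.
rewrite nbhsE; split=> [[V [[B sB <-] [W BW Wp]] VU]|[a pa aU]].
  have [a _ aW] := sB W BW; exists a; rewrite aW //.
  by apply: subset_trans VU; exact: bigcup_sup.
exists (Dspec a) => //; split=> //; exists [set Dspec a]; last exact: bigcup_set1.
by move=> _ ->; exists a.
Qed.

Lemma nbhs_constructibleP p (U : set (Spec T)) :
  nbhs (p : constructible_Spec T) U <->
  exists a b, (Dspec a `\` Dspec b) p /\ Dspec a `\` Dspec b `<=` U.
Proof.
rewrite nbhsE; split=> [[V [[B sB <-] [W BW Wp]] VU]|[a [b [pab abU]]]].
  have [a [b WE]] := sB W BW; exists a, b; rewrite -WE; split=> //.
  by apply: subset_trans VU; exact: bigcup_sup.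
exists (Dspec a `\` Dspec b) => //; split=> //.
exists [set Dspec a `\` Dspec b]; last exact: bigcup_set1.
by move=> _ ->; exists a, b.
Qed.

(** If [p] is in the closure, [a] outside [p] and [b] inside, then the
    neighbourhood [Dspec a `\` Dspec b] of [p] contains a maximal ideal, which
    refutes [he_le a b] by [he_le_Max]; the argument can be reversed. *)
Lemma JspecP p :
  Jspec T p <-> forall a b, he_le a b -> spec_ideal p b -> spec_ideal p a.
Proof.
split=> [pJ a b /he_le_Max ab pb|pJ U /nbhs_constructibleP].
  apply: contrapT => pa.
  have [|m [Mm [ma mb]]] := pJ (Dspec a `\` Dspec b).
    by apply/nbhs_constructibleP; exists a, b; split=> //; split=> //; apply.
  by have [] := ab m (conj ma Mm).
move=> [a [b [[pa /contrapT pb] abU]]]; apply: contrapT => /nonemptyPn U0.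
apply/pa/(pJ a b) => //; apply/he_le_Max => m [ma Mm]; split=> // mb.
have : (Max T `&` U) m by split=> //; apply: abU; split=> //; apply.
by rewrite U0.
Qed.

End JacobsonSpectrum.

Section QuotientLattice.
Context {d} {T : tbDistrLatticeType d} {d'} {T' : tbDistrLatticeType d'}.
Variable f : BoundedLatticeMorphism.type T T'.
Hypothesis f_surj : range f = setT.

Let f_onto c : exists a, f a = c.
Proof. by have [a _ <-] : range f c; [rewrite f_surj | exists a]. Qed.

Lemma dual_map_inj : injective (dual_map f).
Proof.
move=> q r /(congr1 (@spec_ideal _ _)) /= E; apply/spec_ext/funext => c.
by have [a <-] := f_onto c; exact: (congr1 (@^~ a) E).
Qed.

(** The prime of [T'] lying over [p] is the direct image of [p]: the condition
    on [p] says that [f a] is in this image only if [a] is in [p], whence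
    primality passes from [p] to its image. *)
Lemma range_dual_map p :
  range (dual_map f) p <->
  forall a b, (f a <= f b)%O -> spec_ideal p b -> spec_ideal p a.
Proof.
split=> [[q _ <-] a b ab qb|psat].
  by have [[_ _ qle] _] := spec_prime q; exact: qle ab qb.
have fpP a : (f @` spec_ideal p) (f a) <-> spec_ideal p a.
  by split=> [[b pb ba]|pa]; [apply: psat pb; rewrite ba | exists a].
have [[p0 pU _] [p1 pI _]] := spec_prime p.
have fp : prime_ideal (f @` spec_ideal p).
  split; split.
  - by exists \bot%O => //; rewrite omorph0.
  - by move=> _ _ [a pa <-] [b pb <-]; rewrite -omorphU; apply/fpP/pU.
  - move=> c c' cb [b pb fb]; have [a ac] := f_onto c.
    by rewrite -ac; apply/fpP; apply: psat pb; rewrite fb ac.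
  - have <- : f \top%O = \top%O by rewrite omorph1.
    by move=> /fpP.
  - move=> c c'; have [a <-] := f_onto c; have [b <-] := f_onto c'.
    rewrite -omorphI => pa pb /fpP; apply: pI => ?; [apply: pa|apply: pb];
      exact/fpP.
  - move=> c c'; have [a <-] := f_onto c; have [b <-] := f_onto c'.
    by move=> ab pa /fpP pb; apply/pa/fpP; exact: psat pb.
by exists (MkSpec fp) => //; apply/spec_ext/seteqP; split=> a /fpP.
Qed.

(** [A] is a variable, and not [range (dual_map f)] itself, so that the
    homeomorphism lands in the subspace type of any set known to equal it. *)
Lemma dual_map_homeomorphism (A : set (Spec T)) : A = range (dual_map f) ->
  exists h : Spec T' -> set_type A,
    homeomorphism h /\ forall q, set_val (h q) = dual_map f q.
Proof.
move=> AE; have Af q : A (dual_map f q) by rewrite AE; exists q.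
pose h q : set_type A := SigSub (mem_set (Af q)).
have hE q : set_val (h q) = dual_map f q by [].
have /choice[g gE] (x : set_type A) : exists q, h q = x.
  case: x => p pA; have [q _ qp] : range (dual_map f) p.
    by rewrite -AE; exact: set_mem.
  by exists q; exact: val_inj.
exists h; split=> //; exists g; split=> //.
- by move=> q; apply: dual_map_inj; rewrite -!hE gE.
- apply: continuous_comp_initial => q U /nbhs_SpecP[a qa aU].
  by apply/nbhs_SpecP; exists (f a) => // r ra; exact: aU.
(* Continuity of the inverse: Dspec c, for c = f a, is the inverse image under
   the dual map of the open set Dspec a. *)
- move=> x U /nbhs_SpecP[c gxc cU]; have [a ac] := f_onto c.
  have valE y : set_val y = dual_map f (g y) by rewrite -hE gE.
  suff: nbhs x (set_val @^-1` Dspec a).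
    apply: filterS => y ya; apply: cU.
    by move: ya; rewrite /= valE /Dspec /= ac.
  apply: initial_continuous; apply/nbhs_SpecP; exists a => //.
  by rewrite valE /Dspec /= ac.
Qed.

End QuotientLattice.

Lemma he_pi_surj d (T : tbDistrLatticeType d) : range (@he_pi d T) = setT.
Proof.
by apply/seteqP; split=> // u _; have [a ->] := he_piP u; exists a.
Qed.

Lemma Jspec_range d (T : tbDistrLatticeType d) :
  Jspec T = range (dual_map (@he_pi d T)).
Proof.
have dualP p := @range_dual_map _ _ _ _ (@he_pi d T) (@he_pi_surj d T) p.
apply/seteqP; split=> p.
  by move=> /JspecP pJ; apply/dualP => a b /le_he_pi; exact: pJ.
by move=> /dualP pJ; apply/JspecP => a b ab; apply: pJ; exact/le_he_pi.
Qed.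

Theorem mainTheorem1 (d : Order.disp_t) (T : tbDistrLatticeType d) :
  [/\ spectral_subspace (Jspec T),
      exists h : Spec (He T) -> set_type (Jspec T),
        homeomorphism h /\
        (forall q : Spec (He T), set_val (h q) = dual_map (@he_pi d T) q)
    & forall a b : T,
        Dspec a `&` Max T `<=` Dspec b `&` Max T <-> he_le a b].
Proof.
split; last exact: he_le_Max.
  exists d, (He T), (@he_pi d T).
  by split; [exact: he_pi_surj | exact: Jspec_range].
exact: (dual_map_homeomorphism (@he_pi_surj d T) (@Jspec_range d T)).
Qed.
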